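(* For all integers $n\ge 1$ and $k\ge 0$ and every real $x$, $$\frac{d}{dx}B_k^n(x)=n\left(B_{k-1}^{n-1}(x)-B_k^{n-1}(x)\right),$$ where $B_k^n$ denotes the Bernstein basis function.
   Context: The Bernstein basis functions are $B_k^n(x)=\binom{n}{k}x^k(1-x)^{n-k}$ for integers $0\le k\le n$, with the convention that $B_k^n(x)=0$ when $k<0$ or $k>n$ (and $0^0=1$). *)

(* Defs.v *)
From mathcomp Require Import all_boot all_order all_algebra.
From mathcomp Require Import all_classical all_reals all_analysis.

Set Implicit Arguments.
Unset Strict Implicit.
Unset Printing Implicit Defensive.

Import Order.TTheory GRing.Theory Num.Theory.
Import numFieldNormedType.Exports.

Local Open Scope ring_scope.

(* The lower index ranges over int, so that B_{-1}^n is available as 0. For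
   0 <= k <= n the value `|k| is k itself, read as a nat. *)
Definition bernstein (R : realType) (n : nat) (k : int) (x : R) : R :=
  if (0 <= k <= n%:Z) then
    'C(n, `|k|)%:R * x ^+ `|k| * (1 - x) ^+ (n - `|k|)
  else 0.

(* Main.v *)
Require Import Defs.
From mathcomp Require Import all_boot all_order all_algebra.
From mathcomp Require Import all_classical all_reals all_analysis.
From mathcomp Require Import ring.

Import Order.TTheory GRing.Theory Num.Theory.
Import numFieldNormedType.Exports.

Local Open Scope ring_scope.

(** The product rule applied to ['C(n, k) * x ^ k * (1 - x) ^ (n - k)] gives two terms, which match
    the two terms of the claim separately. What remains is a pair of absorption identities:
    [k * 'C(n, k) = n * 'C(n - 1, k - 1)] ([mul_bin_diag]) and
    [(n - k) * 'C(n, k) = n * 'C(n - 1, k)] ([mul_bin_down]). *)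

Lemma bernstein_nat (R : realType) (n k : nat) (x : R) :
  bernstein n k x = 'C(n, k)%:R * x ^+ k * (1 - x) ^+ (n - k).
Proof.
rewrite /bernstein /= lez_nat; case: leqP => // lt_nk.
by rewrite bin_small // !mul0r.
Qed.

(** Product and chain rules. At exponent 0 the truncated predecessor is harmless, since its
    coefficient [k%:R] or [l%:R] is 0. *)
Lemma is_derive_monomial (R : realType) (c : R) (k l : nat) (x : R) :
  is_derive x 1 (fun y : R => c * y ^+ k * (1 - y) ^+ l)
    (c * (k%:R * x ^+ k.-1 * (1 - x) ^+ l - l%:R * x ^+ k * (1 - x) ^+ l.-1)).
Proof.
have dl : is_derive x 1 (fun y : R => 1 - y) (- 1).
  rewrite -[- 1]sub0r.
  exact: is_deriveB (is_derive_cst (1 : R) x 1) (is_derive_id x 1).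
have dX (f : R -> R) d m : is_derive x 1 f d ->
    is_derive x 1 (fun y => f y ^+ m) (m%:R * f x ^+ m.-1 * d).
  by move=> df; have := is_deriveX m df; rewrite exprfctE.
apply: (is_derive_eq (is_deriveM (is_deriveM (is_derive_cst c x 1)
  (dX _ _ k (is_derive_id x 1))) (dX _ _ l dl))).
rewrite /GRing.scale /= mulrfctE /cst; ring.
Qed.

Theorem corollary1 (R : realType) (n : nat) (k : int) (hn : (1 <= n)%N)
  (hk : 0 <= k) (x : R) :
  is_derive x 1 (bernstein n k : R -> R)
    (n%:R * (bernstein n.-1 (k - 1) x - bernstein n.-1 k x)).
Proof.
case: k hk => [k _|//]; case: n hn => [//|m _].
have -> : bernstein m.+1 k =
    (fun y : R => 'C(m.+1, k)%:R * y ^+ k * (1 - y) ^+ (m.+1 - k)).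
  by apply/funext => y; rewrite bernstein_nat.
apply: is_derive_eq (is_derive_monomial _ _ _ _ _) _.
rewrite !mulrBr; congr (_ - _).
  (* For [k = 0] the left side has the factor 0, and the basis function of index -1 is 0 by its
     range test. *)
  case: k => [|j]; first by rewrite !mul0r !mulr0.
  have -> : j.+1%:Z - 1 = j by rewrite -addn1 PoszD addrK.
  rewrite bernstein_nat subSS /=.
  by rewrite !mulrA -!natrM [('C(_, _) * _)%N]mulnC mul_bin_diag.
(* No case split on [k <= m] is needed: with truncated subtraction [(m.+1 - k).-1] is always
   [m - k], and [mul_bin_down] holds for all [k]. *)
rewrite bernstein_nat /= !mulrA -!natrM mulnC.
by rewrite -mul_bin_down -subnS subSS.
Qed.
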